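(* Let $\{\mathbf{w}_t\}_{t=0}^\infty\subset\mathbb{R}^{nr\circ l}$ be the gradient descent trajectory $\mathbf{w}_{t+1}=\mathbf{w}_t-\eta\nabla h^l(\mathbf{w}_t)$ (stepsize $\eta$) of the lifted problem $\min_{\mathbf{w}\in\mathbb{R}^{nr\circ l}}h^l(\mathbf{w})$. If $\mathbf{w}_0$ is a symmetric rank-1 tensor, then $\mathbf{w}_t$ is a symmetric tensor for every $t\ge 0$.
   Context: Let $n,r,m,l$ be positive integers with $r\le n$. $A_1,\dots,A_m\in\mathbb{R}^{n\times n}$ are symmetric matrices, $\mathcal{A}(M)=(\langle A_1,M\rangle,\dots,\langle A_m,M\rangle)^\top$, $Z\in\mathbb{R}^{n\times r}$, $M^*=ZZ^\top$, $b=\mathcal{A}(M^* )\in\mathbb{R}^m$. $\mathbb{R}^{N\circ l}$ is the space of $l$-way tensors with all dimensions equal to $N$. A tensor is symmetric if its entries are invariant under all permutations of the $l$ indices. Indices in $[nr]$ are identified with pairs $(i,a)\in[n]\times[r]$ through column-stacking vectorization. For $\mathbf{w},\mathbf{v}\in\mathbb{R}^{nr\circ l}$ define $\mathcal{M}(\mathbf{w},\mathbf{v})\in\mathbb{R}^{n\circ 2l}$ by $\mathcal{M}(\mathbf{w},\mathbf{v})_{i_1j_1\dots i_lj_l}=\sum_{a_1,\dots,a_l=1}^r \mathbf{w}_{(i_1,a_1)\dots(i_l,a_l)}\mathbf{v}_{(j_1,a_1)\dots(j_l,a_l)}$. For $\mathbf{T}\in\mathbb{R}^{n\circ 2l}$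 define $\mathcal{A}^l(\mathbf{T})\in\mathbb{R}^{m\circ l}$ by $\mathcal{A}^l(\mathbf{T})_{k_1\dots k_l}=\sum_{i,j}\prod_{s=1}^l (A_{k_s})_{i_sj_s}\,\mathbf{T}_{i_1j_1\dots i_lj_l}$. The lifted objective is $h^l(\mathbf{w})=\|\mathcal{A}^l(\mathcal{M}(\mathbf{w},\mathbf{w}))-b^{\otimes l}\|_F^2$. *)

(* Defs.v *)
From HB Require Import structures.
From mathcomp Require Import all_boot all_order all_algebra all_fingroup.
From mathcomp Require Import all_classical all_reals all_analysis.

Set Implicit Arguments.
Unset Strict Implicit.
Unset Printing Implicit Defensive.

Import Order.TTheory GRing.Theory Num.Theory.
Import numFieldNormedType.Exports.

Local Open Scope ring_scope.

(* R^o is R viewed as a module over itself; it gives tensors the entrywise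
   R-module structure. *)
Notation tensor R N l := {ffun {ffun 'I_l -> 'I_N} -> R^o}.

Section Tensors.
Context {R : realType}.

Definition symmetric_tensor (N l : nat) (w : tensor R N l) : Prop :=
  forall (s : 'S_l) (J : {ffun 'I_l -> 'I_N}),
    w [ffun k => J (s k)] = w J.

Definition outer (N l : nat) (x : 'I_l -> 'cV[R]_N) : tensor R N l :=
  [ffun J : {ffun 'I_l -> 'I_N} => \prod_(s < l) x s (J s) ord0].

Definition tensor_power (N l : nat) (x : 'cV[R]_N) : tensor R N l :=
  outer (fun _ : 'I_l => x).

(* The zero tensor has rank 0, not 1. *)
Definition rank1_tensor (N l : nat) (w : tensor R N l) : Prop :=
  w <> 0 /\ exists x : 'I_l -> 'cV[R]_N, w = outer x.

Definition tensor_norm (N l : nat) (w : tensor R N l) : R :=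
  Num.sqrt (\sum_(J : {ffun 'I_l -> 'I_N}) (w J : R) ^+ 2).

Definition basis_tensor (N l : nat) (J : {ffun 'I_l -> 'I_N}) : tensor R N l :=
  [ffun K : {ffun 'I_l -> 'I_N} => (K == J)%:R].

(* The J-th entry is the partial derivative of h at w in the entry w_J, that
   is, the gradient for the Frobenius inner product.  [derive1] is total, but
   the functions differentiated below are polynomial in the entries of w. *)
Definition gradient (N l : nat) (h : tensor R N l -> R) (w : tensor R N l) :
    tensor R N l :=
  [ffun J : {ffun 'I_l -> 'I_N} =>
     derive1 (fun t : R => h (w + t *: basis_tensor J)) 0].

End Tensors.

Lemma vec_index_subproof (n r : nat) (i : 'I_n) (a : 'I_r) :
  (a * n + i < n * r)%N.
Proof.
apply: (@leq_trans (a.+1 * n)); first by rewrite mulSn addnC ltn_add2r.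
by rewrite [leqRHS]mulnC leq_mul2r ltn_ord orbT.
Qed.

(* Position of the (i, a) entry of an n x r matrix in its column-stacking
   vectorization. *)
Definition vec_index (n r : nat) (i : 'I_n) (a : 'I_r) : 'I_(n * r) :=
  Ordinal (vec_index_subproof i a).

Lemma ipos_subproof (l : nat) (s : 'I_l) : (2 * s < 2 * l)%N.
Proof. by rewrite ltn_pmul2l. Qed.

Lemma jpos_subproof (l : nat) (s : 'I_l) : ((2 * s).+1 < 2 * l)%N.
Proof. by rewrite !mul2n -doubleS ltn_Sdouble. Qed.

(* In the 2l indices (i_1, j_1, ..., i_l, j_l), the positions of i_s and j_s
   (all counted from 0). *)
Definition ipos (l : nat) (s : 'I_l) : 'I_(2 * l) := Ordinal (ipos_subproof s).
Definition jpos (l : nat) (s : 'I_l) : 'I_(2 * l) := Ordinal (jpos_subproof s).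

Section LiftedProblem.
Context {R : realType}.

(* <A, M> = tr (A^T M). *)
Definition mx_inner (n : nat) (A M : 'M[R]_n) : R := \sum_i \sum_j A i j * M i j.

Definition sensing (n m : nat) (A : 'I_m -> 'M[R]_n) (M : 'M[R]_n) : 'cV[R]_m :=
  \col_(k < m) mx_inner (A k) M.

Definition lifted_prod (n r l : nat) (w v : tensor R (n * r) l) :
    tensor R n (2 * l) :=
  [ffun K : {ffun 'I_(2 * l) -> 'I_n} =>
     \sum_(a : {ffun 'I_l -> 'I_r})
        (w [ffun s => vec_index (K (ipos s)) (a s)] : R)
        * v [ffun s => vec_index (K (jpos s)) (a s)]].

(* The index K runs over all (i_1, j_1, ..., i_l, j_l). *)
Definition lifted_sensing (n m l : nat) (A : 'I_m -> 'M[R]_n)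
    (T : tensor R n (2 * l)) : tensor R m l :=
  [ffun k : {ffun 'I_l -> 'I_m} =>
     \sum_(K : {ffun 'I_(2 * l) -> 'I_n})
        (\prod_(s < l) A (k s) (K (ipos s)) (K (jpos s))) * (T K : R)].

Definition lifted_objective (n r m l : nat) (A : 'I_m -> 'M[R]_n)
    (b : 'cV[R]_m) (w : tensor R (n * r) l) : R :=
  tensor_norm (lifted_sensing A (lifted_prod w w) - tensor_power l b) ^+ 2.

Definition gd_trajectory (N l : nat) (h : tensor R N l -> R) (eta : R)
    (w : nat -> tensor R N l) : Prop :=
  forall t : nat, w t.+1 = w t - eta *: gradient h (w t).

End LiftedProblem.

(* Main.v *)
(** Permuting the l indices of w permutes the entries of A^l(M(w, w)) in the
    same way, and both the Frobenius norm and the power b^(o l) are invariant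
    under such permutations; hence h^l is invariant. The gradient of an invariant
    function at a symmetric tensor is symmetric, so gradient steps preserve
    symmetry. *)
Require Import Defs.
From mathcomp Require Import all_boot all_order all_algebra all_fingroup.
From mathcomp Require Import all_classical all_reals all_analysis.

Set Implicit Arguments.
Unset Strict Implicit.
Unset Printing Implicit Defensive.

Import Order.TTheory GRing.Theory Num.Theory.

Local Open Scope ring_scope.

(** The index type is arbitrary because both ['I_l] (acted on by a permutation) and ['I_(2 * l)]
    (acted on by the induced map on pairs) occur below. *)
Definition ffun_precomp (I : finType) (T : Type) (f : I -> I)
    (J : {ffun I -> T}) : {ffun I -> T} :=
  [ffun k => J (f k)].

Lemma ffun_precomp_bij (I : finType) (T : Type) (f : I -> I) :
  bijective f -> bijective (@ffun_precomp I T f).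
Proof.
by case=> g fK gK; exists (ffun_precomp g) => J; apply/ffunP=> k;
  rewrite !ffunE ?fK ?gK.
Qed.

Section PermuteTensor.
Context {R : realType}.

Definition permute_tensor (N l : nat) (s : 'S_l) (w : tensor R N l) :
    tensor R N l :=
  [ffun J => w (ffun_precomp s J)].

Definition permutation_invariant (N l : nat) (h : tensor R N l -> R) : Prop :=
  forall s w, h (permute_tensor s w) = h w.

Lemma perm_bij (l : nat) (s : 'S_l) : bijective s.
Proof. exact: injF_bij (@perm_inj _ s). Qed.

Lemma symmetric_tensorP (N l : nat) (w : tensor R N l) :
  symmetric_tensor w <-> forall s, permute_tensor s w = w.
Proof.
split=> [w_sym s|w_fix s J].
  by apply/ffunP=> J; rewrite ffunE; exact: w_sym.
by rewrite -[in RHS](w_fix s) ffunE.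
Qed.

Lemma permute_tensorB (N l : nat) (s : 'S_l) (v w : tensor R N l) :
  permute_tensor s (v - w) = permute_tensor s v - permute_tensor s w.
Proof. by apply/ffunP=> J; rewrite !ffunE. Qed.

Lemma permute_tensor_line (N l : nat) (s : 'S_l) (t : R) (v w : tensor R N l) :
  permute_tensor s (v + t *: w) = permute_tensor s v + t *: permute_tensor s w.
Proof. by apply/ffunP=> J; rewrite !ffunE. Qed.

Lemma permute_basis_tensor (N l : nat) (s : 'S_l) (J : {ffun 'I_l -> 'I_N}) :
  permute_tensor s (basis_tensor (ffun_precomp s J)) =
    basis_tensor J :> tensor R N l.
Proof.
apply/ffunP=> K; rewrite !ffunE.
by rewrite (inj_eq (bij_inj (ffun_precomp_bij _ (perm_bij s)))).
Qed.

Lemma tensor_norm_permute (N l : nat) :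
  permutation_invariant (@tensor_norm R N l).
Proof.
move=> s w; rewrite /tensor_norm.
rewrite [in RHS](reindex (ffun_precomp s)) /=; last first.
  exact/onW_bij/ffun_precomp_bij/perm_bij.
by congr Num.sqrt; apply: eq_bigr => J _; rewrite ffunE.
Qed.

Lemma tensor_power_sym (N l : nat) (x : 'cV[R]_N) :
  symmetric_tensor (tensor_power l x).
Proof.
move=> s J; rewrite !ffunE [RHS](reindex s) /=; last exact/onW_bij/perm_bij.
by apply: eq_bigr => k _; rewrite ffunE.
Qed.

(** Since [s] fixes [w], it carries the line through [w] in the direction of the basis tensor at
    [J \o s] onto the line in the direction of the one at [J]. By invariance [h] restricts to the
    same function of [t] on both lines, so the two values of [derive1] coincide. *)
Lemma gradient_sym (N l : nat) (h : tensor R N l -> R) (w : tensor R N l) :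
  permutation_invariant h -> symmetric_tensor w ->
  symmetric_tensor (gradient h w).
Proof.
move=> h_inv /symmetric_tensorP w_fix s J; rewrite !ffunE.
congr (derive1 _ 0); apply/funext => t.
by rewrite -(h_inv s) permute_tensor_line w_fix permute_basis_tensor.
Qed.

Lemma gd_trajectory_sym (N l : nat) (h : tensor R N l -> R) (eta : R)
    (w : nat -> tensor R N l) :
  permutation_invariant h -> gd_trajectory h eta w ->
  symmetric_tensor (w 0%N) -> forall t, symmetric_tensor (w t).
Proof.
move=> h_inv w_gd w0_sym; elim=> [//|t wt_sym].
have g_sym := gradient_sym h_inv wt_sym.
(* The step is written as [w t + (- eta) *: g], the shape on which permutations act by linearity. *)
rewrite w_gd -scaleNr; apply/symmetric_tensorP => s.
by rewrite permute_tensor_line !(symmetric_tensorP _).1.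
Qed.

End PermuteTensor.

Section PairPermutation.
Context {l : nat}.

Lemma half_ord_subproof (q : 'I_(2 * l)) : (q./2 < l)%N.
Proof. by rewrite ltn_half_double -mul2n. Qed.

(** Moves each pair (i_s, j_s) as a block: [q./2] is the number of the pair and the parity of [q]
    tells i from j. *)
Definition pair_map (f : 'I_l -> 'I_l) (q : 'I_(2 * l)) : 'I_(2 * l) :=
  let s := f (Ordinal (half_ord_subproof q)) in
  if odd q then jpos s else ipos s.

Lemma pair_map_ipos (f : 'I_l -> 'I_l) (s : 'I_l) :
  pair_map f (ipos s) = ipos (f s).
Proof.
rewrite /pair_map /= oddM /=; congr (ipos (f _)).
by apply: val_inj; rewrite /= mul2n doubleK.
Qed.

Lemma pair_map_jpos (f : 'I_l -> 'I_l) (s : 'I_l) :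
  pair_map f (jpos s) = jpos (f s).
Proof.
rewrite /pair_map /= oddM /=; congr (jpos (f _)).
(* The half of [(2 * s).+1] simplifies to [uphalf (2 * s)], which is again [s]. *)
by apply: val_inj; rewrite /= mul2n uphalf_double.
Qed.

Lemma pair_map_id (q : 'I_(2 * l)) : pair_map id q = q.
Proof.
apply: val_inj; rewrite /pair_map -[RHS]odd_double_half -mul2n.
by case: (odd q).
Qed.

(** Functoriality: with [pair_map_id], it turns an inverse of [f] into an inverse of
    [pair_map f]. *)
Lemma pair_map_comp (f g : 'I_l -> 'I_l) (q : 'I_(2 * l)) :
  pair_map f (pair_map g q) = pair_map (f \o g) q.
Proof.
by rewrite [pair_map g q]/pair_map [RHS]/pair_map; case: (odd q);
  rewrite ?pair_map_ipos ?pair_map_jpos.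
Qed.

Lemma pair_map_bij (f : 'I_l -> 'I_l) : bijective f -> bijective (pair_map f).
Proof.
case=> g fK gK; exists (pair_map g) => q; rewrite pair_map_comp.
  by rewrite (_ : g \o f = id) ?pair_map_id //; apply/funext.
by rewrite (_ : f \o g = id) ?pair_map_id //; apply/funext.
Qed.

End PairPermutation.

Section LiftedProblem.
Context {R : realType}.

(** Permuting [w] and [v] moves the index a_s along with i_s and j_s; as a is summed over,
    reindexing absorbs its share of the permutation. *)
Lemma lifted_prod_permute (n r l : nat) (s : 'S_l)
    (w v : tensor R (n * r) l) (K : {ffun 'I_(2 * l) -> 'I_n}) :
  lifted_prod (permute_tensor s w) (permute_tensor s v) K =
    lifted_prod w v (ffun_precomp (pair_map s) K).
Proof.
rewrite !ffunE [RHS](reindex (ffun_precomp s)) /=; last first.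
  exact/onW_bij/ffun_precomp_bij/perm_bij.
apply: eq_bigr => a _; rewrite !ffunE.
by congr (w _ * v _); apply/ffunP=> k;
  rewrite !ffunE ?pair_map_ipos ?pair_map_jpos.
Qed.

Lemma lifted_sensing_permute (n r m l : nat) (A : 'I_m -> 'M[R]_n) (s : 'S_l)
    (w v : tensor R (n * r) l) :
  lifted_sensing A (lifted_prod (permute_tensor s w) (permute_tensor s v)) =
    permute_tensor s (lifted_sensing A (lifted_prod w v)).
Proof.
apply/ffunP=> k; rewrite ffunE [RHS]ffunE [RHS]ffunE.
rewrite [RHS](reindex (ffun_precomp (pair_map s))) /=; last first.
  exact/onW_bij/ffun_precomp_bij/pair_map_bij/perm_bij.
apply: eq_bigr => K _; rewrite lifted_prod_permute; congr (_ * _).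
(* After the change of variable in [K], the two products have the same factors in an order that
   differs by [s]. *)
rewrite (reindex s) /=; last exact/onW_bij/perm_bij.
by apply: eq_bigr => u _; rewrite !ffunE pair_map_ipos pair_map_jpos.
Qed.

Lemma lifted_objective_permute (n r m l : nat) (A : 'I_m -> 'M[R]_n)
    (b : 'cV[R]_m) :
  permutation_invariant (@lifted_objective R n r m l A b).
Proof.
move=> s w; rewrite /lifted_objective lifted_sensing_permute.
(* Replacing the symmetric power of [b] by its permuted copy lets [s] be pulled out of the whole
   residual. *)
rewrite -[tensor_power l b in LHS]((symmetric_tensorP _).1 _ s).
  by rewrite -permute_tensorB tensor_norm_permute.
exact: tensor_power_sym.
Qed.

End LiftedProblem.

Theorem lemma1 (R : realType) (n r m l : nat)
    (n_gt0 : (0 < n)%N) (r_gt0 : (0 < r)%N) (m_gt0 : (0 < m)%N)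
    (l_gt0 : (0 < l)%N) (r_le_n : (r <= n)%N)
    (A : 'I_m -> 'M[R]_n) (A_sym : forall k : 'I_m, (A k)^T = A k)
    (Z : 'M[R]_(n, r)) (eta : R) (w : nat -> tensor R (n * r) l)
    (w_gd : gd_trajectory
              (lifted_objective A (sensing A (Z *m Z^T))) eta w)
    (w0_sym : symmetric_tensor (w 0%N)) (w0_rank1 : rank1_tensor (w 0%N)) :
  forall t : nat, symmetric_tensor (w t).
Proof.
exact: gd_trajectory_sym (@lifted_objective_permute _ _ _ _ _ _ _) w_gd w0_sym.
Qed.
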